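(* Let $m,n\ge 1$ be integers. The number of spherical $K_{m+1,n}$-parking functions is \[ |\mathrm{sPF}(K_{m+1,n})|=\sum_{i=1}^{m+n}(-1)^{m+n-i}\sum_{(\mathbf{s},\mathbf{t})\in\Gamma_i}\binom{m}{s_1,\,s_2-s_1,\,\dots,\,s_i-s_{i-1}}\binom{n}{t_1,\,t_2-t_1,\,\dots,\,t_i-t_{i-1}}\,\mu(\mathbf{s},\mathbf{t}). \]
   Context: $\mathbb{N}=\{0,1,2,\dots\}$, $[N]=\{1,\dots,N\}$. $K_{m+1,n}$ is the complete bipartite graph on $\{0,1,\dots,m\}\sqcup\{m+1,\dots,m+n\}$ with root $0$ (in the part of size $m+1$). Spherical parking functions: let $G$ be an undirected loopless graph on $V=\{0,1,\dots,N\}$, $N\ge2$, with root $0$ and $a_{ij}$ edges between $i$ and $j$ (here $N=m+n$). Let $R=\mathbb{K}[x_1,\dots,x_N]$ over a field $\mathbb{K}$. For $\emptyset\ne A\subseteq[N]$ put $d_A(i)=\sum_{j\in V\setminus A}a_{ij}$ and $m_A=\prod_{i\in A}x_i^{d_A(i)}$. Let $\mathcal{M}_G=\langle m_A:\emptyset\neq A\subseteq[N]\rangle$ and $\mathcal{M}_G^{(k)}=\langle m_A:\emptyset\ne A\subseteq[N],\ |A|\le k+1\rangle$. Then $\mathrm{sPF}(G)=\{\mathcal{P}\in\mathbb{N}^N:\ \mathbf{x}^{\mathcal{P}}\in\mathcal{M}_G\setminus\mathcal{M}_G^{(N-2)}\}$. For $1\le i\le m+n$, $\Gamma_i$ is the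 set of ordered pairs $(\mathbf{s},\mathbf{t})$ of $i$-tuples of nonnegative integers $\mathbf{s}=(s_1,\dots,s_i)$, $\mathbf{t}=(t_1,\dots,t_i)$ such that $0=s_0\le s_1\le\cdots\le s_i$, $0=t_0\le t_1\le\cdots\le t_i$, $s_i+t_i=m+n$, and $s_{j-1}+t_{j-1}<s_j+t_j$ for $1\le j\le i$. A multinomial coefficient $\binom{p}{c_1,\dots,c_i}$ equals $p!/(c_1!\cdots c_i!)$ if $c_1+\cdots+c_i=p$ and $0$ otherwise (so only pairs with $s_i=m$, $t_i=n$ contribute). For $(\mathbf{s},\mathbf{t})\in\Gamma_i$ let $\mathfrak{T}(\mathbf{s},\mathbf{t})=\{j\in[i]: s_j<m\text{ and }t_j<n\}$ and \[ \mu(\mathbf{s},\mathbf{t})=\prod_{j\in\mathfrak{T}(\mathbf{s},\mathbf{t})}(n-t_j)^{s_j-s_{j-1}}(m-s_j)^{t_j-t_{j-1}}, \] with the empty product equal to $1$. *)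

(* Defs.v *)
From HB Require Import structures.
From mathcomp Require Import all_boot all_order all_algebra.
From mathcomp Require Import finmap.
From mathcomp Require Import mpoly.

Set Implicit Arguments.
Unset Strict Implicit.
Unset Printing Implicit Defensive.

Import GRing.Theory.
Local Open Scope ring_scope.

(* Undirected loopless multigraph on {0, ..., N}, root 0;
   [edges G i j] is the number a_ij of edges between i and j. *)
Record rooted_graph (N : nat) := RootedGraph {
  edges :> 'I_N.+1 -> 'I_N.+1 -> nat;
  edges_sym : forall i j, edges i j = edges j i;
  edges_loopless : forall i, edges i i = 0%N
}.

Lemma Kbip_sym m n (i j : 'I_(m + n).+1) :
  nat_of_bool ((i <= m)%N != (j <= m)%N) =
  nat_of_bool ((j <= m)%N != (i <= m)%N).
Proof. by rewrite eq_sym. Qed.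

Lemma Kbip_loopless m n (i : 'I_(m + n).+1) :
  nat_of_bool ((i <= m)%N != (i <= m)%N) = 0%N.
Proof. by rewrite eqxx. Qed.

(* K_{m+1,n}, with parts {0, ..., m} and {m+1, ..., m+n}. *)
Definition Kbip (m n : nat) : rooted_graph (m + n) :=
  RootedGraph (@Kbip_sym m n) (@Kbip_loopless m n).

(* The index i : 'I_N stands for the non-root vertex i + 1. *)
Definition vertex (N : nat) (i : 'I_N) : 'I_N.+1 := lift ord0 i.

Definition outdeg (N : nat) (G : rooted_graph N) (A : {set 'I_N}) (i : 'I_N)
  : nat :=
  (\sum_(j | j \notin [set vertex k | k in A]) G (vertex i) j)%N.

Definition cut_mon (K : fieldType) (N : nat) (G : rooted_graph N)
  (A : {set 'I_N}) : {mpoly K[N]} :=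
  \prod_(i in A) 'X_i ^+ outdeg G A i.

Definition in_ideal (R : comNzRingType) (I : finType) (P : pred I) (g : I -> R)
  (p : R) : Prop :=
  exists c : I -> R, p = \sum_(i | P i) c i * g i.

Definition in_MG (K : fieldType) (N : nat) (G : rooted_graph N)
  (p : {mpoly K[N]}) : Prop :=
  in_ideal (fun A : {set 'I_N} => A != set0) (cut_mon K G) p.

Definition in_MGk (K : fieldType) (N : nat) (G : rooted_graph N) (k : nat)
  (p : {mpoly K[N]}) : Prop :=
  in_ideal (fun A : {set 'I_N} => (A != set0) && (#|A| <= k.+1)%N)
    (cut_mon K G) p.

(* Only meaningful for N >= 2, since N - 2 is truncated. *)
Definition sPF (K : fieldType) (N : nat) (G : rooted_graph N)
  (P : 'X_{1..N}) : Prop :=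
  in_MG G ('X_[P] : {mpoly K[N]}) /\ ~ in_MGk G (N - 2) ('X_[P] : {mpoly K[N]}).

(* [entry s j] is s_j for s = (s_1, ..., s_i) and 0 <= j <= i, with s_0 = 0. *)
Definition entry (b i : nat) (s : i.-tuple 'I_b) (j : nat) : nat :=
  nth 0%N (0%N :: [seq val x | x <- s]) j.

Definition increments (b i : nat) (s : i.-tuple 'I_b) : seq nat :=
  [seq (entry s j - entry s j.-1)%N | j <- iota 1 i].

(* The entries are at most s_i + t_i = m + n, so tuples over 'I_(m + n).+1
   lose nothing. *)
Definition Gamma (m n i : nat)
  : {set i.-tuple 'I_(m + n).+1 * i.-tuple 'I_(m + n).+1} :=
  [set st | [&& (entry st.1 i + entry st.2 i == m + n)%N
    & all (fun j => [&& (entry st.1 j.-1 <= entry st.1 j)%N,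
                        (entry st.2 j.-1 <= entry st.2 j)%N
                      & (entry st.1 j.-1 + entry st.2 j.-1
                           < entry st.1 j + entry st.2 j)%N])
          (iota 1 i)]].

Definition multinomial_coef (p : nat) (c : seq nat) : nat :=
  if sumn c == p then (p`! %/ \prod_(x <- c) x`!)%N else 0%N.

Definition mu (m n i : nat)
  (st : i.-tuple 'I_(m + n).+1 * i.-tuple 'I_(m + n).+1) : nat :=
  let s := entry st.1 in let t := entry st.2 in
  (\prod_(1 <= j < i.+1 | (s j < m) && (t j < n))
     ((n - t j) ^ (s j - s j.-1) * (m - s j) ^ (t j - t j.-1)))%N.

(* Main.v *)
Require Import Defs.
From HB Require Import structures.
From mathcomp Require Import all_boot all_order all_algebra.
From mathcomp Require Import finmap.
From mathcomp Require Import mpoly.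
From mathcomp Require Import zify ring.

Set Implicit Arguments.
Unset Strict Implicit.
Unset Printing Implicit Defensive.

Import GRing.Theory.
Local Open Scope ring_scope.

(**
Let L and R be the two sides of K_{m,n}, obtained by deleting the root.
Subtracting the edges to the root, a spherical parking function becomes a
vector x with no proper nonempty set A such that x v is at least the number
[codeg A v] of neighbours of v outside A for all v in A.  The sets A containing
L or R only say that x has a zero on L and a zero on R; call the other sets
loose.

For such an x the loose sets A dominated by x are closed under union, so if
there are any they have a maximum, and the Euler characteristic of the chains
of these sets is the indicator of x being standard.  Counting x in a box of
side K gives, for every loose A, with N(B) the number of vectors standard
above B and l, r the numbers of vertices of L, R outside A,
  (K^l - (K-1)^l) (K^r - (K-1)^r)
    = N(A) + sum_{B > A loose} prod_{v in B \ A} (K - codeg B v) N(B).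
Here N does not depend on K, so this is a polynomial identity in K; at K = 0
it expresses N(A) through the N(B).  The right-hand side of the theorem,
rewritten as a signed sum over chains of subsets of L + R, satisfies the same
recursion: the chains continuing after the last loose set with sets containing
L or R, which all carry the factor 1, have total sign 1.
*)

(** * Standard vectors relative to a vertex set *)

Section Bipartite.
Variables (V : finType) (L : {set V}).
Implicit Types (A B C D M : {set V}) (v : V) (x : V -> nat).

Definition opposite v := if v \in L then ~: L else L.
Definition codeg A v := #|opposite v :\: A|.
Definition loose A := ~~ (L \subset A) && ~~ (~: L \subset A).
(* Domination is only required outside [A]: for [v] in a dominated [A] it is
   automatic, as [codeg] decreases when the set grows. *)
Definition covers A B x := [forall v in B :\: A, codeg B v <= x v]%N.
Definition has_holes A x :=
  [exists v in L :\: A, x v == 0%N] && [exists v in ~: L :\: A, x v == 0%N].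
(** Only the values outside [A] enter. [has_holes] takes care of the sets containing a whole side,
    so that only loose sets remain to be excluded. *)
Definition standard A x :=
  has_holes A x && [forall B, loose B && (A \proper B) ==> ~~ covers A B x].

Lemma codegS A B v : A \subset B -> (codeg B v <= codeg A v)%N.
Proof. by move=> sAB; apply/subset_leq_card/setDS. Qed.

Lemma codeg_gt0 A v : loose A -> (0 < codeg A v)%N.
Proof.
rewrite /loose /codeg /opposite -!setD_eq0 -!card_gt0 => /andP[lA rA].
by case: ifP.
Qed.

Lemma codeg_le A v : (codeg A v <= #|V|)%N.
Proof. exact: max_card. Qed.

Lemma covers_trans A B C x :
  A \subset B -> B \subset C -> covers A B x -> covers B C x -> covers A C x.
Proof.
move=> sAB sBC /forall_inP cAB /forall_inP cBC; apply/forall_inP=> v.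
rewrite inE => /andP[vA vC]; case vB: (v \in B).
  by apply: leq_trans (codegS _ sBC) (cAB v _); rewrite inE vA.
by apply: cBC; rewrite inE vB.
Qed.

Lemma coversW A B C x : A \subset B -> covers A C x -> covers B C x.
Proof.
move=> sAB /forall_inP cAC; apply/forall_inP=> v; rewrite inE => /andP[vB vC].
by apply: cAC; rewrite inE vC andbT; apply: contra vB; apply: (subsetP sAB).
Qed.

Lemma coversU A B C x : covers A B x -> covers A C x -> covers A (B :|: C) x.
Proof.
move=> /forall_inP cB /forall_inP cC; apply/forall_inP=> v.
rewrite !inE => /andP[vA] /orP[vB|vC].
  by apply: leq_trans (codegS _ (subsetUl _ _)) (cB v _); rewrite inE vA.
by apply: leq_trans (codegS _ (subsetUr _ _)) (cC v _); rewrite inE vA.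
Qed.

Lemma covers_gt0 A B x v : loose B -> covers A B x -> v \notin A -> v \in B ->
  (0 < x v)%N.
Proof.
move=> lB /forall_inP cB vA vB.
by apply: leq_trans (codeg_gt0 v lB) (cB v _); rewrite inE vA.
Qed.

(* The zeros of [x] on each side cannot lie in a covered loose set, on which
   [x] is positive. *)
Lemma has_holesE A B x : loose B -> A \subset B -> covers A B x ->
  has_holes B x = has_holes A x.
Proof.
move=> lB sAB cB.
have nz v : x v == 0%N -> v \notin A -> v \notin B.
  move=> /eqP xv vA; apply/negP=> vB.
  by have := covers_gt0 lB cB vA vB; rewrite xv.
suff E M : [exists v in M :\: B, x v == 0%N] = [exists v in M :\: A, x v == 0%N].
  by rewrite /has_holes !E.
apply/exists_inP/exists_inP=> -[v]; rewrite inE => /andP[h vM] xv; exists v => //.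
  by rewrite inE vM andbT; apply: contra h; apply: (subsetP sAB).
by rewrite inE vM (nz v).
Qed.

Lemma has_holes_loose A x : has_holes A x -> loose A.
Proof.
move=> /andP[/exists_inP[v vL _] /exists_inP[w wR _]].
rewrite /loose; apply/andP; split; apply/subsetPn.
  by exists v; move: vL; rewrite inE => /andP[].
by exists w; move: wR; rewrite inE => /andP[].
Qed.

(** The holes of [x] lie outside every loose set covered above [A], so the union exhausts neither
    side. *)
Lemma looseU A B C x : has_holes A x -> loose B -> loose C ->
  covers A B x -> covers A C x ->
  loose (B :|: C).
Proof.
move=> hA lB lC cB cC.
have nz D v : loose D -> covers A D x -> x v = 0%N -> v \notin A -> v \notin D.
  move=> lD cD xv vA; apply/negP=> vD.
  by have := covers_gt0 lD cD vA vD; rewrite xv.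
apply: (@has_holes_loose _ x);
  move: hA => /andP[/exists_inP[v vL /eqP xv] /exists_inP[w wR /eqP xw]].
move: vL wR; rewrite !inE => /andP[vA vL] /andP[wA wR].
apply/andP; split; apply/exists_inP; [exists v|exists w]; rewrite ?xv ?xw //.
  by rewrite !inE vL andbT negb_or (nz B) ?(nz C).
by rewrite !inE wR andbT negb_or (nz B) ?(nz C).
Qed.

(* The loose sets covered by [x] above [A] are closed under union, so if there
   are any they have a largest element, the only one above which [x] is
   standard. *)
Lemma standard_partition A x : has_holes A x ->
  (standard A x +
   \sum_(B | loose B && (A \proper B) && covers A B x) standard B x = 1)%N.
Proof.
move=> hA; pose Q B := loose B && (A \proper B) && covers A B x.
rewrite {1}/standard hA /=; case: (pickP Q) => [B0 QB0 | Q0]; last first.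
  rewrite big_pred0 ?addn0 //; case: forallP => // -[] B.
  by apply/implyP=> hB; move: (Q0 B); rewrite /Q hB /= => ->.
case: forallP => [/(_ B0)|_] /=.
  by move: QB0; rewrite /Q => /andP[-> ->].
rewrite add0n; case: (arg_maxnP (fun B : {set V} => #|B|) QB0) => M QM maxM.
have /andP[/andP[lM pM] cM] := QM; have sM := proper_sub pM.
have Qsub B : Q B -> B \subset M.
  move=> QB; have /andP[/andP[lB pB] cB] := QB; have sB := proper_sub pB.
  have QU : Q (B :|: M).
    rewrite /Q (looseU hA) //= coversU // andbT.
    by apply: proper_sub_trans pB (subsetUl _ _).
  have /eqP -> : M == B :|: M by rewrite eqEcard subsetUr; apply: maxM.
  exact: subsetUl.
(* [M] contributes 1, since a larger covered loose set would contradict maximality; any other [B]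
   contributes 0, since [M] lies properly above it and is covered. *)
rewrite (bigD1 M) //= big1 => [|B /andP[QB neB]].
  rewrite addn0 /standard (has_holesE lM sM cM) hA /=.
  apply/eqP; rewrite eqb1; apply/forallP=> B; apply/implyP=> /andP[lB pB].
  apply/negP=> cB.
  have /maxM : Q B.
    by rewrite /Q lB (proper_trans pM pB) (covers_trans sM _ cM cB) // proper_sub.
  by rewrite /geq /= leqNgt proper_card.
apply/eqP; rewrite eqb0 /standard negb_and; apply/orP; right.
apply/forallPn; exists M; rewrite lM negb_imply negbK /=.
by rewrite properEneq neB Qsub //= (coversW _ cM) // proper_sub //;
  have /andP[/andP[]] := QB.
Qed.

Lemma eq_standard A x y : {in ~: A, x =1 y} -> standard A x = standard A y.
Proof.
move=> exy; have E v M : v \in M :\: A -> x v = y v.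
  by rewrite inE => /andP[vA _]; apply: exy; rewrite inE.
congr andb; first by congr andb; apply: eq_existsb => v; apply: andb_id2l => /E ->.
apply: eq_forallb => B; congr (_ ==> ~~ _).
by apply: eq_forallb => v; apply: implyb_id2l => /E ->.
Qed.

(** If [v |: A] is loose, it is not covered, which bounds [x v] by a codegree; otherwise [v] is the
    only vertex of its side outside [A], so the hole on that side is [v] itself. *)
Lemma standard_bound A x v :
  standard A x -> v \notin A -> (x v <= #|V|)%N.
Proof.
move=> /andP[hA /forallP stA] vA; have lA := has_holes_loose hA.
case lAv: (loose (v |: A)).
  have := stA (v |: A); rewrite lAv properUr ?sub1set // => /forall_inPn[w].
  rewrite !inE => /andP[wA]; rewrite (negPf wA) orbF => /eqP ->.
  by rewrite -ltnNge => /ltnW /leq_trans -> //; apply: codeg_le.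
suff -> : x v = 0%N by [].
have uniq_hole M : v \in M -> M \subset v |: A ->
    [exists w in M :\: A, x w == 0%N] -> x v = 0%N.
  move=> vM /subsetP sM /exists_inP[w]; rewrite inE => /andP[wA wM] /eqP.
  by have := sM w wM; rewrite !inE (negPf wA) orbF => /eqP ->.
have nsub M : v \notin M -> M \subset v |: A -> M \subset A.
  move=> vM /subsetP sM; apply/subsetP=> w wM; have := sM w wM.
  by rewrite !inE => /orP[/eqP ewv|//]; rewrite -ewv wM in vM.
move: hA lA lAv => /andP[hL hR] /andP[nL nR] /negbT.
rewrite /loose negb_and !negbK; case vL: (v \in L) => /orP[] sM.
- exact: uniq_hole hL.
- by rewrite (nsub _ _ sM) ?inE ?vL in nR.
- by rewrite (nsub _ _ sM) ?vL in nL.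
- by apply: uniq_hole hR; rewrite ?inE ?vL.
Qed.

(** * Counting standard vectors in a box *)

Section Counting.
Variable k : nat.
Local Notation box := {ffun V -> 'I_k.+1}.
Implicit Types (f g : box).

(** Vanishing on [A] picks one representative among the functions that agree outside [A]. *)
Definition zero_on A f := [forall v in A, f v == ord0].

Definition nb_standard A :=
  #|[set f : box | zero_on A f && standard A (val \o f)]|.

(** [Q] depends only on the coordinates outside [A], so those inside are chosen independently;
    [merge] glues the two choices. *)
Lemma card_box_prod A (F : V -> pred 'I_k.+1) (Q : pred box) :
    (forall f g, {in ~: A, f =1 g} -> Q f = Q g) ->
  #|[set f : box | [forall v in A, F v (f v)] && Q f]| =
  (\prod_(v in A) #|F v| * #|[set f : box | zero_on A f && Q f]|)%N.
Proof.
move=> invQ; pose pad v := if v \in A then F v else pred1 ord0.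
have -> : (\prod_(v in A) #|F v| = #|[set f : box | f \in family pad]|)%N.
  rewrite cardsE card_family foldrE big_map big_enum /= big_mkcond /=.
  by apply: eq_bigr => v _; rewrite /pad; case: ifP => // _; rewrite card1.
have padP f : reflect (forall v, pad v (f v)) (f \in family pad).
  exact: forallP.
pose merge (p : box * box) : box := [ffun v => if v \in A then p.1 v else p.2 v].
have merge_off p : {in ~: A, merge p =1 p.2}.
  by move=> v; rewrite inE ffunE => /negPf ->.
rewrite -cardsX -(card_in_imset (f := merge)); last first.
  case=> g h [g' h']; rewrite !in_setX !in_set /=.
  move=> /and3P[/padP Fg /forall_inP zh _] /and3P[/padP Fg' /forall_inP zh' _].
  move=> /ffunP E; congr pair; apply/ffunP=> v; move: (E v); rewrite !ffunE /=.
    case: ifP => vA // _; move: (Fg v) (Fg' v); rewrite /pad vA /=.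
    by move=> /eqP -> /eqP ->.
  by case: ifP => vA // _; rewrite (eqP (zh v vA)) (eqP (zh' v vA)).
apply: eq_card => f; rewrite in_set; apply/andP/imsetP => [[/forall_inP Ff Qf]|].
  exists ([ffun v => if v \in A then f v else ord0],
          [ffun v => if v \in A then ord0 else f v]).
    rewrite in_setX !in_set /=; apply/and3P; split.
    - by apply/padP=> v; rewrite ffunE /pad; case: ifP => // vA; apply: Ff.
    - by apply/forall_inP=> v vA; rewrite ffunE vA.
    by rewrite -(invQ f) // => v; rewrite inE ffunE => /negPf ->.
  by apply/ffunP=> v; rewrite !ffunE /=; case: (v \in A).
case=> -[g h]; rewrite in_setX !in_set /= => /and3P[/padP Fg _ Qh] ->.
split; last by rewrite (invQ _ h) //; apply: merge_off.
by apply/forall_inP=> v vA; rewrite ffunE vA; move: (Fg v); rewrite /pad vA.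
Qed.

Lemma card_ord_geq c : #|[pred i : 'I_k.+1 | c <= i]%N| = (k.+1 - c)%N.
Proof.
rewrite -sum1_card (eq_bigl (fun i : 'I_k.+1 => c <= i)%N) //.
by rewrite -(big_geq_mkord c k.+1 xpredT (fun=> 1%N)) sum_nat_const_nat muln1.
Qed.

Lemma card_covers A B : A \subset B ->
  #|[set f : box |
     [&& zero_on A f, covers A B (val \o f) & standard B (val \o f)]]| =
  (\prod_(v in B :\: A) (k.+1 - codeg B v) * nb_standard B)%N.
Proof.
move=> sAB.
pose F v : pred 'I_k.+1 :=
  if v \in A then pred1 ord0 else [pred i : 'I_k.+1 | codeg B v <= i]%N.
have invS f g : {in ~: B, f =1 g} ->
    standard B (val \o f) = standard B (val \o g).
  by move=> efg; apply: eq_standard => v vB /=; rewrite efg.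
transitivity #|[set f : box |
    [forall v in B, F v (f v)] && standard B (val \o f)]|.
  apply: eq_card => f; rewrite !inE andbA; congr (_ && _).
  apply/andP/forall_inP => [[/forall_inP zA /forall_inP cB] v vB|FB].
    rewrite /F; case: ifP => vA; first exact: zA.
    by apply: cB; rewrite inE vA.
  split; apply/forall_inP=> v.
    by move=> vA; have := FB v (subsetP sAB v vA); rewrite /F vA.
  by rewrite inE => /andP[vA vB]; have := FB v vB; rewrite /F (negPf vA).
rewrite card_box_prod //; congr (_ * _)%N.
rewrite (big_setID A) /= (setIidPr sAB) big1 ?mul1n => [|v vA].
  by apply: eq_bigr => v; rewrite inE /F => /andP[/negPf -> _]; apply: card_ord_geq.
by rewrite /F vA card1.
Qed.

(** Inclusion-exclusion over the two events that a side has no zero outside [A]. *)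
Lemma card_has_holes A :
  #|[set f : box | zero_on A f && has_holes A (val \o f)]|%:Z =
  (k.+1%:Z ^+ #|L :\: A| - k%:Z ^+ #|L :\: A|) *
  (k.+1%:Z ^+ #|~: L :\: A| - k%:Z ^+ #|~: L :\: A|).
Proof.
pose pos (b : bool) M f := b ==> [forall v in M :\: A, f v != ord0].
have count bl br :
    #|[set f : box | [&& zero_on A f, pos bl L f & pos br (~: L) f]]|%:Z =
    (if bl then k else k.+1)%:Z ^+ #|L :\: A| *
    (if br then k else k.+1)%:Z ^+ #|~: L :\: A|.
  pose F v : pred 'I_k.+1 := if v \in A then pred1 ord0 else
    if if v \in L then bl else br then predC1 ord0 else predT.
  have -> : [set f : box | [&& zero_on A f, pos bl L f & pos br (~: L) f]] =
            [set f in family F].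
    apply/setP=> f; rewrite !inE; apply/and3P/familyP => [[/forall_inP zA pl pr] v|Ff].
      rewrite /F; case: ifP => vA; first exact: zA.
      case vL: (v \in L); case: ifP => // h.
        by move: pl; rewrite /pos h => /forall_inP/(_ v); rewrite !inE vA vL; apply.
      by move: pr; rewrite /pos h => /forall_inP/(_ v); rewrite !inE vA vL; apply.
    split.
    - by apply/forall_inP=> v vA; have := Ff v; rewrite /F vA.
    - apply/implyP=> h; apply/forall_inP=> v; rewrite inE => /andP[/negPf vA vL].
      by have := Ff v; rewrite /F vA vL h.
    apply/implyP=> h; apply/forall_inP=> v; rewrite !inE => /andP[/negPf vA /negPf vL].
    by have := Ff v; rewrite /F vA vL h.
  have cF v : #|F v| = if v \in A then 1%N else
      if v \in L then (if bl then k else k.+1) else (if br then k else k.+1).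
    rewrite /F; case: ifP => _; first by rewrite card1.
    by case: (v \in L); [case: (bl) | case: (br)]; rewrite ?cardC1 card_ord.
  rewrite cardsE card_family foldrE big_map big_enum /= (bigID (mem A)) /=.
  rewrite big1 ?mul1n => [|v vA]; last by rewrite cF vA.
  rewrite (bigID (mem L)) /= (eq_bigr (fun=> if bl then k else k.+1)); last first.
    by move=> v /andP[/negPf vA vL]; rewrite cF vA vL.
  rewrite mulnC (eq_bigr (fun=> if br then k else k.+1)); last first.
    by move=> v /andP[/negPf vA /negPf vL]; rewrite cF vA vL.
  rewrite !prod_nat_const mulnC PoszM -!natz !natrX.
  by congr (_ ^+ _ * _ ^+ _); apply: eq_card => v; rewrite !inE.
have sumE (Q : pred box) : #|[set f | Q f]|%:Z = \sum_f (Q f : nat)%:Z.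
  by rewrite -sum1_card big_mkcond /= -natz natr_sum; apply: eq_bigr => f _;
    rewrite inE natz; case: (Q f).
have := (count false false, count false true, count true false, count true true).
move=> [[[c00 c01] c10] c11]; move: c00 c01 c10 c11; rewrite /pos /= !sumE.
move=> c00 c01 c10 c11.
transitivity (\sum_f ((zero_on A f : nat)%:Z
   - ([&& zero_on A f, true & [forall v in ~: L :\: A, f v != ord0]] : nat)%:Z
   - ([&& zero_on A f, [forall v in L :\: A, f v != ord0] & true] : nat)%:Z
   + ([&& zero_on A f, [forall v in L :\: A, f v != ord0]
        & [forall v in ~: L :\: A, f v != ord0]] : nat)%:Z)).
  apply: eq_bigr => f _.
  have E M : [exists v in M :\: A, (val \o f) v == 0%N] =
      ~~ [forall v in M :\: A, f v != ord0].
    rewrite negb_forall; apply: eq_existsb => v.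
    by rewrite negb_imply negbK.
  rewrite /has_holes !E; case: (zero_on A f) => //=.
  by case: [forall _ in _, _]; case: [forall _ in _, _].
rewrite big_split sumrB sumrB /= c01 c10 c11.
under [X in X - _ - _ + _]eq_bigr => f _ do rewrite -[zero_on A f]andbT.
rewrite c00; ring.
Qed.

(** By [standard_partition], the vectors with holes above [A] are sorted by the set above which they
    are standard: [A] itself or a covered loose set. The bound on [k] keeps the subtractions from
    being truncated. *)
Lemma nb_standard_rec A : (#|V| <= k)%N ->
  (k.+1%:Z ^+ #|L :\: A| - k%:Z ^+ #|L :\: A|) *
  (k.+1%:Z ^+ #|~: L :\: A| - k%:Z ^+ #|~: L :\: A|) =
  (nb_standard A)%:Z + \sum_(B | loose B && (A \proper B))
    \prod_(v in B :\: A) (k.+1%:Z - (codeg B v)%:Z) * (nb_standard B)%:Z.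
Proof.
move=> leVk; rewrite -card_has_holes.
have -> : #|[set f : box | zero_on A f && has_holes A (val \o f)]| =
  (nb_standard A + \sum_(B | loose B && (A \proper B))
    \prod_(v in B :\: A) (k.+1 - codeg B v) * nb_standard B)%N.
  rewrite (eq_bigr (fun B : {set V} => #|[set f : box | [&& zero_on A f,
     covers A B (val \o f) & standard B (val \o f)]]|)); last first.
    by move=> B /andP[_ /proper_sub sAB]; rewrite card_covers.
  rewrite /nb_standard.
  have sumE (Q : pred box) : #|[set f | Q f]| = (\sum_f (Q f : nat))%N.
    by rewrite -sum1_card big_mkcond /=; apply: eq_bigr => f _; rewrite inE;
      case: (Q f).
  rewrite !sumE; under [X in (_ + X)%N]eq_bigr => B _ do rewrite sumE.
  rewrite exchange_big -big_split; apply: eq_bigr => f _ /=.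
  case: (zero_on A f) => /=; last by rewrite big1.
  case hA: (has_holes A (val \o f)) => /=.
    rewrite -(standard_partition hA); congr (_ + _)%N; rewrite big_mkcondr /=;
      apply: eq_bigr => B _.
    by case: covers.
  rewrite {1}/standard hA big1 // => B /andP[lB /proper_sub sAB].
  apply/eqP; rewrite eqb0; apply/negP=> /andP[cB /andP[hB _]].
  by rewrite (has_holesE lB sAB cB) hA in hB.
rewrite PoszD; congr (_ + _); rewrite -natz natr_sum; apply: eq_bigr => B _.
rewrite natz PoszM; congr (_ * _); rewrite -natz natr_prod.
apply: eq_bigr => v _; rewrite natz subzn //.
by apply: leqW; apply: leq_trans (codeg_le _ _) leVk.
Qed.
End Counting.

(** By [standard_bound] the larger box contains no further standard vectors. *)
Lemma nb_standard_indep A k l : (#|V| <= k)%N -> (k <= l)%N ->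
  nb_standard k A = nb_standard l A.
Proof.
move=> leVk lekl; have lt : (k.+1 <= l.+1)%N by [].
pose w (f : {ffun V -> 'I_k.+1}) : {ffun V -> 'I_l.+1} :=
  [ffun v => widen_ord lt (f v)].
have winj : injective w.
  move=> f g /ffunP E; apply/ffunP=> v; move: (E v); rewrite !ffunE => /(congr1 val) /=.
  exact: val_inj.
have zw f : zero_on A (w f) = zero_on A f.
  by apply: eq_forallb => v; rewrite ffunE.
have sw f : standard A (val \o w f) = standard A (val \o f).
  by apply: eq_standard => v _ /=; rewrite ffunE.
rewrite /nb_standard -(card_imset _ winj); apply: eq_card => g; rewrite inE.
apply/imsetP/andP => [[f]|[zg sg]].
  by rewrite inE => /andP[zf sf] ->; rewrite zw sw.
have gk v : (g v < k.+1)%N.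
  case vA: (v \in A); first by rewrite (eqP (forall_inP zg v vA)).
  by rewrite ltnS; apply: leq_trans leVk; apply: (standard_bound sg); rewrite vA.
have eg : g = w [ffun v => inord (g v)].
  by apply/ffunP=> v; rewrite !ffunE; apply: val_inj; rewrite /= inordK.
by exists [ffun v => inord (g v)] => //; rewrite inE -zw -sw -eg zg.
Qed.

Lemma nb_standard_sign_rec A k : (#|V| <= k)%N -> loose A ->
  (-1) ^+ #|~: A| =
  (nb_standard k A)%:Z + \sum_(B | loose B && (A \proper B))
    (-1) ^+ #|B :\: A| * (\prod_(v in B :\: A) codeg B v)%:Z * (nb_standard k B)%:Z.
Proof.
move=> leVk lA.
pose q (l r : nat) : {poly int} := ('X ^+ l - ('X - 1) ^+ l) * ('X ^+ r - ('X -
  1) ^+ r).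
pose p : {poly int} := q #|L :\: A| #|~: L :\: A| - ((nb_standard k A)%:Z%:P +
  \sum_(B | loose B && (A \proper B))
    (\prod_(v in B :\: A) ('X - (codeg B v)%:Z%:P)) * (nb_standard k B)%:Z%:P).
have pE z : p.[z] = (z ^+ #|L :\: A| - (z - 1) ^+ #|L :\: A|) *
    (z ^+ #|~: L :\: A| - (z - 1) ^+ #|~: L :\: A|) -
  ((nb_standard k A)%:Z + \sum_(B | loose B && (A \proper B))
    \prod_(v in B :\: A) (z - (codeg B v)%:Z) * (nb_standard k B)%:Z).
  rewrite /p /q !hornerE; congr (_ - (_ + _)).
  rewrite horner_sum; apply: eq_bigr => B _; rewrite !hornerE horner_prod.
  by congr (_ * _); apply: eq_bigr => v _; rewrite !hornerE.
(* The counts are the same in all boxes with bound at least [k], so [p] vanishes at every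
   [k + i + 1], which is more than enough roots. *)
have p0 : p = 0.
  apply: (@roots_geq_poly_eq0 _ _ [seq (k + i).+1%:Z | i <- iota 0 (size p)]).
  - apply/allP=> _ /mapP[i _ ->]; apply/rootP; rewrite pE.
    have -> : (k + i).+1%:Z - 1 = (k + i)%:Z by rewrite -addn1 PoszD addrK.
    rewrite nb_standard_rec ?(leq_trans leVk) ?leq_addr //.
    rewrite -(nb_standard_indep A leVk (leq_addr i k)).
    under eq_bigr => B _ do rewrite -(nb_standard_indep B leVk (leq_addr i k)).
    by rewrite subrr.
  - rewrite map_inj_uniq ?iota_uniq // => i j [] /addnI //.
  - by rewrite size_map size_iota.
have := pE 0; rewrite p0 horner0 => /eqP; rewrite eq_sym subr_eq0 => /eqP.
(* Looseness makes both exponents positive, so at 0 the left side is a single sign. *)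
move: lA; rewrite /loose -!setD_eq0 -!card_gt0 => /andP[lA rA].
rewrite !expr0n !gtn_eqF // !sub0r mulrNN -exprD.
have -> : (#|L :\: A| + #|~: L :\: A| = #|~: A|)%N.
  by rewrite -(cardsID L (~: A)); congr (_ + _)%N; apply: eq_card => v;
    rewrite !inE // andbC.
move=> ->; congr (_ + _); apply: eq_bigr => B _; congr (_ * _).
rewrite -natz natr_prod -prodr_const -big_split /=.
by apply: eq_bigr => v _; rewrite sub0r natz mulN1r.
Qed.

(** * Signed sums over chains of sets *)

Lemma sum_sign_supersets A :
  \sum_(B : {set V} | A \subset B) (-1) ^+ #|~: B| = (A == setT)%:Z.
Proof.
have [->|] := eqVneq A setT.
  rewrite (big_pred1 setT) ?setCT ?cards0 // => B.
  by rewrite /= subTset.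
rewrite -subTset => /subsetPn[v _ vA].
set S := \sum_(_ | _) _; suff : S = - S by lia.
(* Toggling the vertex [v] outside [A] is a sign-reversing involution of the supersets of [A]. *)
pose h B := if v \in B then B :\ v else v |: B.
have hK : involutive h.
  move=> B; rewrite /h; case vB: (v \in B).
    by rewrite !inE eqxx /= setD1K.
  by rewrite setU11 setU1K ?vB.
rewrite /S {1}(reindex_inj (inv_inj hK)) /= -sumrN; apply: eq_big => [B|B _].
  rewrite /h; case: ifP => vB; first by rewrite subsetD1 vA andbT.
  apply/subsetP/subsetP => sAB w wA; last by rewrite !inE sAB ?orbT.
  by have := sAB w wA; rewrite !inE => /orP[/eqP ewv|//]; rewrite -ewv wA in vA.
rewrite /h; case: ifP => vB.
  have -> : ~: (B :\ v) = v |: ~: B by rewrite setCD setUC.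
  by rewrite cardsU1 !inE vB exprS mulN1r.
have -> : ~: (v |: B) = ~: B :\ v by rewrite setCU setDE setIC.
by rewrite (cardsD1 v (~: B)) !inE vB exprS mulN1r opprK.
Qed.

(** The weight of one step of a chain, matching one factor of [mu]; a step to a set containing a
    side has weight 1, like the indices left out of that product. *)
Definition cover_weight A B :=
  (if loose B then \prod_(v in B :\: A) codeg B v else 1)%N.

Section SignedChains.
Variable Psi : {set V} -> int.
(** Unfolded, [Psi A] is the sum over strictly increasing chains from [A] to [setT] of the products
    of step weights, signed by the number of steps. *)
Hypothesis Psi_rec : forall A,
  Psi A = (A == setT)%:Z - \sum_(B : {set V} | A \proper B) (cover_weight A
    B)%:Z * Psi B.

(** All sets above [A] contain the same side, so every weight is 1 and the recursion is the one that
    [sum_sign_supersets] gives for the signs. *)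
Lemma signed_chains_tight A : ~~ loose A -> Psi A = (-1) ^+ #|~: A|.
Proof.
have [c] := ubnP #|~: A|; elim: c A => // c IH A ltA nlA.
rewrite Psi_rec -sum_sign_supersets (bigD1 A) //=.
rewrite [X in _ - X](eq_bigr (fun B : {set V} => (-1) ^+ #|~: B|)) => [|B pB].
  apply/eqP; rewrite subr_eq; apply/eqP; congr (_ + _).
  by apply: eq_bigl => B; rewrite properEneq eq_sym andbC.
have nlB : ~~ loose B.
  move: nlA; rewrite /loose !negb_and !negbK.
  by case/orP=> /subset_trans /(_ (proper_sub pB)) ->; rewrite ?orbT.
rewrite /cover_weight (negPf nlB) mul1r IH //.
by apply: leq_trans (proper_card _) ltA; rewrite properC.
Qed.

(** Inclusion-exclusion over the side contained in [B]: each side alone gives alternating sum 0, and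
    [setT], the only set containing both, is subtracted once. *)
Lemma sum_sign_tight A : loose A ->
  \sum_(B : {set V} | (A \proper B) && ~~ loose B) (-1) ^+ #|~: B| = -1 :> int.
Proof.
move=> lA; have /andP[nL nR] := lA.
have nT M : ~~ (~: M \subset A) -> (A :|: M == setT) = false.
  move=> /subsetPn[v vM vA]; apply/negP=> /eqP/setP/(_ v).
  by move: vM; rewrite !inE (negPf vA) => /negPf ->.
have sL := sum_sign_supersets (A :|: L); have sR := sum_sign_supersets (A :|: ~: L).
have sT := sum_sign_supersets setT.
rewrite nT // in sL; rewrite nT ?setCK // in sR; rewrite eqxx in sT.
suff -> : \sum_(B : {set V} | (A \proper B) && ~~ loose B) (-1) ^+ #|~: B| =
   \sum_(B : {set V} | A :|: L \subset B) (-1) ^+ #|~: B| +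
   \sum_(B : {set V} | A :|: ~: L \subset B) (-1) ^+ #|~: B| -
   \sum_(B : {set V} | setT \subset B) (-1) ^+ #|~: B| :> int.
  by rewrite sL sR sT.
rewrite big_mkcond [X in _ = X + _ - _]big_mkcond [X in _ = _ + X - _]big_mkcond.
rewrite [X in _ = _ + _ - X]big_mkcond /= -big_split -sumrB /=; apply: eq_bigr => B _.
have -> : (A \proper B) && ~~ loose B = (A \subset B) && ~~ loose B.
  apply: andb_id2r => nlB; rewrite properEneq.
  by case: eqP => // eAB; rewrite -eAB lA in nlB.
have -> : (setT \subset B) = (L \subset B) && (~: L \subset B).
  by rewrite -subUset setUCr.
rewrite !subUset /loose negb_and !negbK.
case sAB: (A \subset B) => /=; last first.
  case sLB: (L \subset B); case sRB: (~: L \subset B); rewrite ?subr0 //=.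
  move: sAB; rewrite (subset_trans (subsetT _)) //.
  by rewrite -(setUCr L) subUset sLB sRB.
by case: (L \subset B); case: (~: L \subset B); rewrite /= ?addr0 ?add0r ?subr0 ?addrK.
Qed.

(** Induction on the size of the complement. By [sum_sign_tight] the tight supersets contribute 1 to
    the recursion, which then is [nb_standard_sign_rec] multiplied by [(-1) ^+ #|~: A|]. *)
Lemma signed_chains_loose k A : (#|V| <= k)%N -> loose A ->
  Psi A = (-1) ^+ #|~: A| * (nb_standard k A)%:Z.
Proof.
move=> leVk; have [c] := ubnP #|~: A|; elim: c A => // c IH A ltA lA.
have neT : A == setT = false.
  by apply/negP=> /eqP eA; move: lA; rewrite eA /loose subsetT.
rewrite Psi_rec neT (bigID loose) /=.
rewrite [X in _ - (_ + X)](eq_bigr (fun B : {set V} => (-1) ^+ #|~: B|)); last first.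
  by move=> B /andP[_ nlB]; rewrite /cover_weight (negPf nlB) mul1r signed_chains_tight.
rewrite sum_sign_tight //.
have := nb_standard_sign_rec leVk lA => /(congr1 ( *%R ((-1) ^+ #|~: A|))).
rewrite -expr2 sqrr_sign mulrDr => /eqP; rewrite -subr_eq => /eqP <-.
set S1 := \sum_(_ | _) _; set S2 := \sum_(_ | _) _;
  suff : S1 = (-1) ^+ #|~: A| * S2 by lia.
rewrite mulr_sumr.
apply: eq_big => [B|B /andP[pB lB]]; first by rewrite andbC.
have ltB : (#|~: B| < #|~: A|)%N by rewrite proper_card // properC.
rewrite IH ?(leq_trans ltB) // /cover_weight lB.
have -> : (-1) ^+ #|~: A| = (-1) ^+ #|B :\: A| * (-1) ^+ #|~: B| :> int.
  rewrite -exprD -(cardsID B (~: A)); congr (_ ^+ (_ + _)); apply: eq_card => v.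
    by rewrite !inE.
  rewrite !inE; have := subsetP (proper_sub pB) v.
  by case: (v \in A); case: (v \in B) => // ->.
have sq : (-1) ^+ #|B :\: A| * (-1) ^+ #|B :\: A| = 1 :> int.
  by rewrite -expr2 sqrr_sign.
by rewrite -[X in _ = _ * X]mulrA [RHS]mulrACA sq mul1r mulrCA.
Qed.

End SignedChains.
End Bipartite.

(** * From sets to the sizes of their two sides *)

Section Sizes.
Variables (V : finType) (L : {set V}).
Implicit Types (A B X Y : {set V}).
Local Notation m := #|L|.
Local Notation n := #|~: L|.

(** The parts of [B :\: A] on the two sides are chosen independently, and [join] assembles them. The
    Boolean factor removes the cases where truncated subtraction would leave a nonzero binomial. *)
Lemma card_supersets A (s t : nat) :
  #|[set B : {set V} | [&& A \subset B, #|B :&: L| == s & #|B :\: L| == t]]| =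
  ((#|A :&: L| <= s) && (#|A :\: L| <= t) *
   ('C(m - #|A :&: L|, s - #|A :&: L|) * 'C(n - #|A :\: L|, t - #|A :\: L|)))%N.
Proof.
case: andP => [[les let_]|nle]; last first.
  rewrite mul0n; apply/eqP; rewrite cards_eq0; apply/eqP/setP=> B; rewrite !inE.
  apply/negP=> /and3P[sAB /eqP es /eqP et]; apply: nle; rewrite -es -et.
  by split; apply: subset_leq_card; [apply: setSI | apply: setSD].
have -> : (m - #|A :&: L| = #|L :\: A|)%N by rewrite cardsD setIC.
have -> : (n - #|A :\: L| = #|~: L :\: A|)%N by rewrite [RHS]cardsD setDE setIC.
rewrite mul1n -!cards_draws -cardsX.
pose join (p : {set V} * {set V}) := A :|: (p.1 :|: p.2).
have joinL (p : {set V} * {set V}) : p.1 \subset L :\: A -> p.2 \subset ~: L :\: A ->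
    (join p :&: L) :\: A = p.1 /\ (join p :\: L) :\: A = p.2.
  move=> /subsetP s1 /subsetP s2; split; apply/setP=> v; rewrite !inE;
    have := s1 v; have := s2 v; rewrite !inE;
    by case: (v \in A); case: (v \in L); case: (v \in p.1);
      case: (v \in p.2) => //= h1 h2;
      do ?[by have := h1 isT | by have := h2 isT].
rewrite -(card_in_imset (f := join)); last first.
  move=> [X Y] [X' Y']; rewrite !in_setX !in_set /=.
  move=> /andP[/andP[sX _] /andP[sY _]] /andP[/andP[sX' _] /andP[sY' _]] E.
  have [eX eY] := joinL (X, Y) sX sY; have [eX' eY'] := joinL (X', Y') sX' sY'.
  by congr pair; [rewrite -[LHS]eX E eX' | rewrite -[LHS]eY E eY'].
have split_card B (M : {set V}) : A \subset B -> #|B :&: M| = (#|A :&: M| +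
  #|(B :&: M) :\: A|)%N.
  move=> sAB; rewrite -(cardsID A (B :&: M)); congr (_ + _)%N.
  by apply: eq_card => v; rewrite !inE; have := subsetP sAB v;
    case: (v \in A) => [/(_ isT) ->|_]; rewrite ?andbT ?andbF.
apply: eq_card => B; rewrite in_set; apply/and3P/imsetP.
  move=> [sAB /eqP es /eqP et].
  exists ((B :&: L) :\: A, (B :\: L) :\: A); last first.
    apply/setP=> v; rewrite !inE; have := subsetP sAB v.
    by case: (v \in A) => [->//|_]; case: (v \in L); case: (v \in B).
  rewrite in_setX !in_set /= -es -et [B :\: L]setDE [A :\: L]setDE.
  rewrite (split_card B L) // (split_card B (~: L)) // !addKn !eqxx !andbT.
  by rewrite !setSD ?subsetIr.
case=> -[X Y];
  rewrite in_setX !in_set /= => /andP[/andP[sX /eqP cX] /andP[sY /eqP cY]] eB.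
have sAB : A \subset B by rewrite eB subsetUl.
have [eX eY] := joinL (X, Y) sX sY; rewrite -eB /= in eX eY.
rewrite [B :\: L]setDE in eY.
split=> //; first by rewrite split_card // eX cX subnKC.
by rewrite setDE split_card // eY cY -setDE subnKC.
Qed.

Lemma sum_supersets A (F : nat -> nat -> int) M : (m < M)%N -> (n < M)%N ->
  \sum_(B : {set V} | A \subset B) F #|B :&: L| #|B :\: L| =
  \sum_(s < M) \sum_(t < M)
    ((#|A :&: L| <= s) && (#|A :\: L| <= t) *
     ('C(m - #|A :&: L|, s - #|A :&: L|) * 'C(n - #|A :\: L|, t - #|A :\: L|)))%N%:Z
    * F s t.
Proof.
move=> ltm ltn.
have bL B : (#|B :&: L| < M)%N by apply: leq_ltn_trans ltm;
  apply: subset_leq_card (subsetIr _ _).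
have bR B : (#|B :\: L| < M)%N.
  by apply: leq_ltn_trans ltn; rewrite setDE; apply: subset_leq_card (subsetIr _ _).
rewrite (partition_big (fun B : {set V} => Ordinal (bL B)) predT) //=.
apply: eq_bigr => s _.
rewrite (partition_big (fun B : {set V} => Ordinal (bR B)) predT) //=.
apply: eq_bigr => t _; rewrite -card_supersets.
rewrite (eq_bigr (fun=> F s t)) => [|B /andP[/andP[_ /eqP <-] /eqP <-]] //.
rewrite sumr_const -mulr_natl natz; congr (_%:Z * _); apply: eq_card => B.
by rewrite inE andbA.
Qed.

Lemma looseE B : loose L B = (#|B :&: L| < m)%N && (#|B :\: L| < n)%N.
Proof.
have E (M : {set V}) : ~~ (M \subset B) = (#|B :&: M| < #|M|)%N.
  rewrite -(cardsID B M) setIC -[X in (X < _)%N]addn0 ltn_add2l card_gt0.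
  by rewrite setD_eq0.
by rewrite /loose !E setDE.
Qed.

(** [codeg B] is constant on each side, as all vertices of a side have the same neighbours. *)
Lemma cover_weightE A B : A \subset B -> cover_weight L A B =
  (if (#|B :&: L| < m) && (#|B :\: L| < n) then
     (n - #|B :\: L|) ^ (#|B :&: L| - #|A :&: L|) *
     (m - #|B :&: L|) ^ (#|B :\: L| - #|A :\: L|) else 1)%N.
Proof.
move=> sAB; rewrite /cover_weight looseE; case: ifP => // _.
have dI (M : {set V}) : (#|B :&: M| - #|A :&: M| = #|(B :\: A) :&: M|)%N.
  rewrite -(cardsID A (B :&: M)); have -> : B :&: M :&: A = A :&: M.
    by apply/setP=> v; rewrite !inE; have := subsetP sAB v;
      case: (v \in A) => [/(_ isT) ->|_]; rewrite ?andbT ?andbF.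
  by rewrite addKn; apply: eq_card => v; rewrite !inE andbA.
rewrite (big_setID L) /= !(setDE _ L) !dI; congr (_ * _)%N.
  rewrite (eq_bigr (fun=> n - #|B :&: ~: L|)%N) ?prod_nat_const // => v.
  by rewrite inE /codeg /opposite => /andP[_ ->]; rewrite cardsD setIC.
rewrite (eq_bigr (fun=> m - #|B :&: L|)%N) ?prod_nat_const // => v.
by rewrite !inE /codeg /opposite => /andP[_ /negPf ->]; rewrite cardsD setIC.
Qed.

End Sizes.

(** * Chains of pairs of sizes *)

Section SizeChains.
Variables m n : nat.

(** The total [cover_weight] of the sets of sizes [s] and [t] properly containing a given set of
    sizes [a] and [b]. *)
Definition step_weight a b s t : nat :=
  if [&& a <= s, b <= t & a + b < s + t]%N then
    ('C(m - a, s - a) * 'C(n - b, t - b) *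
     if (s < m) && (t < n) then (n - t) ^ (s - a) * (m - s) ^ (t - b) else 1)%N
  else 0%N.

Fixpoint chain_sum i a b : nat :=
  if i is i'.+1 then
    (\sum_(s < (m + n).+1) \sum_(t < (m + n).+1)
       step_weight a b s t * chain_sum i' s t)%N
  else (a == m) && (b == n).

(** Each step raises the total size by at least 1, so such a chain is too long. *)
Lemma chain_sum_eq0 i a b : (m + n < a + b + i)%N -> chain_sum i a b = 0%N.
Proof.
elim: i a b => [|i IH] a b /= lti.
  by apply/eqP; rewrite eqb0; apply/negP=> /andP[/eqP ea /eqP eb]; lia.
apply: big1 => s _; apply: big1 => t _; rewrite /step_weight.
by case: ifP => // /and3P[_ _ lt]; rewrite IH ?muln0 //; lia.
Qed.

Definition signed_chain_sum a b : int :=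
  \sum_(i < (m + n).+1) (-1) ^+ i * (chain_sum i a b)%:Z.

Lemma signed_chain_sum_rec a b :
  signed_chain_sum a b = ((a == m) && (b == n))%:Z -
  \sum_(s < (m + n).+1) \sum_(t < (m + n).+1)
    (step_weight a b s t)%:Z * signed_chain_sum s t.
Proof.
rewrite /signed_chain_sum big_ord_recl expr0 mul1r; congr (_ + _).
have E (s t : 'I_(m + n).+1) : (step_weight a b s t)%:Z *
    \sum_(i < (m + n).+1) (-1) ^+ i * (chain_sum i s t)%:Z =
    \sum_(i < m + n) (-1) ^+ i * (step_weight a b s t * chain_sum i s t)%N%:Z.
  (* After a step of nonzero weight [s + t] is positive, so the top length [m + n] contributes
     nothing. *)
  rewrite big_ord_recr /= mulrDr mulr_sumr [X in _ + X](_ : _ = 0).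
    by rewrite addr0; apply: eq_bigr => i _; rewrite mulrCA PoszM.
  rewrite /step_weight; case: ifP => [/and3P[_ _ lt]|_]; last by rewrite mul0r.
  by rewrite chain_sum_eq0 ?mulr0 //; lia.
under [X in _ = - X]eq_bigr => s _ do under eq_bigr => t _ do rewrite E.
under [X in _ = - X]eq_bigr => s _ do rewrite exchange_big.
rewrite exchange_big -sumrN; apply: eq_bigr => i _ /=.
rewrite /bump /= add1n exprS mulN1r mulNr; congr (- _).
rewrite -natz natr_sum mulr_sumr; apply: eq_bigr => s _.
by rewrite natr_sum mulr_sumr; apply: eq_bigr => t _; rewrite natz.
Qed.
End SizeChains.

(** This supplies the hypothesis [Psi_rec]; supersets are grouped by their two sizes. *)
Lemma signed_chain_sum_set (V : finType) (L A : {set V}) :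
  let Psi A := signed_chain_sum #|L| #|~: L| #|A :&: L| #|A :\: L| in
  Psi A = (A == setT)%:Z -
    \sum_(B : {set V} | A \proper B) (cover_weight L A B)%:Z * Psi B.
Proof.
move=> Psi; rewrite /Psi signed_chain_sum_rec.
set M := (_ + _).+1; have ltm : (#|L| < M)%N by rewrite ltnS leq_addr.
have ltn : (#|~: L| < M)%N by rewrite ltnS leq_addl.
congr (_%:Z - _).
  have E (N : {set V}) : (#|A :&: N| == #|N|) = (N \subset A).
    by rewrite (sameP setIidPr eqP) -(geq_leqif (subset_leqif_cards (subsetIr A N)))
      eqn_leq subset_leq_card ?subsetIr.
  by rewrite setDE !E -subUset setUCr subTset.
(* The strict inequality in [F] discards [B = A], as [sum_supersets] runs over all supersets. *)
pose F s t : int := ((#|A :&: L| + #|A :\: L| < s + t) *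
  if (s < #|L|) && (t < #|~: L|) then
    (#|~: L| - t) ^ (s - #|A :&: L|) * (#|L| - s) ^ (t - #|A :\: L|) else 1)%N%:Z *
  signed_chain_sum #|L| #|~: L| s t.
transitivity (\sum_(B : {set V} | A \subset B) F #|B :&: L| #|B :\: L|).
  rewrite (sum_supersets A F ltm ltn); apply: eq_bigr => s _; apply: eq_bigr => t _.
  rewrite /F mulrA -PoszM /step_weight; congr (_%:Z * _).
  case: (_ <= _)%N => //=; case: (_ <= _)%N => //=; rewrite mul1n.
  by case: (_ < _)%N; rewrite ?mul1n ?muln0.
rewrite [LHS]big_mkcond [RHS]big_mkcond; apply: eq_bigr => B _.
rewrite properEcard; case: ifP => sAB //=.
rewrite /F !cardsID cover_weightE //.
by case: (#|A| < #|B|)%N; rewrite ?mul1n ?mul0n ?mul0r.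
Qed.

(** * Multinomial coefficients and the sums over [Gamma] *)

Lemma multinomial_coefK c :
  (multinomial_coef (sumn c) c * \prod_(x <- c) x`! = (sumn c)`!)%N.
Proof.
rewrite /multinomial_coef eqxx divnK //; elim: c => [|x c IH]; first by rewrite big_nil.
rewrite big_cons /= -(bin_fact (leq_addr (sumn c) x)) addKn.
by apply: dvdn_mull; apply: dvdn_mul.
Qed.

Lemma multinomial_coef_cons p x c :
  multinomial_coef p (x :: c) = ('C(p, x) * multinomial_coef (p - x) c)%N.
Proof.
case: (eqVneq (x + sumn c)%N p) => [<-|ne].
  have pos : (0 < \prod_(y <- x :: c) y`!)%N.
    by apply: prodn_gt0 => y; apply: fact_gt0.
  apply/eqP; rewrite -(eqn_pmul2r pos) (multinomial_coefK (x :: c)) addKn.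
  rewrite big_cons mulnACA multinomial_coefK -mulnA.
  by rewrite -[X in X == _](bin_fact (leq_addr (sumn c) x)) addKn.
(* The remaining sum can match [p - x] only by truncation, when [x > p]; then the binomial is 0. *)
rewrite /multinomial_coef /= (negPf ne); case: eqP => [e|]; last by rewrite muln0.
by rewrite bin_small //; lia.
Qed.

(* [entry] and the conditions of [Gamma], for a sequence starting at an
   arbitrary value instead of [0]. *)
Definition entry_from a (s : seq nat) j := nth 0%N (a :: s) j.

Definition increments_from a s :=
  [seq entry_from a s j - entry_from a s j.-1 | j <- iota 1 (size s)]%N.

Definition Gamma_from N a b (s t : seq nat) :=
  (entry_from a s (size s) + entry_from b t (size s) == N)%N &&
  all (fun j => [&& (entry_from a s j.-1 <= entry_from a s j)%N,
                    (entry_from b t j.-1 <= entry_from b t j)%N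
                  & (entry_from a s j.-1 + entry_from b t j.-1
                       < entry_from a s j + entry_from b t j)%N])
      (iota 1 (size s)).

Definition mu_from m n a b (s t : seq nat) :=
  (\prod_(1 <= j < (size s).+1 |
          (entry_from a s j < m) && (entry_from b t j < n))
     ((n - entry_from b t j) ^ (entry_from a s j - entry_from a s j.-1) *
      (m - entry_from a s j) ^ (entry_from b t j - entry_from b t j.-1)))%N.

Lemma entry_fromS a x s j : (0 < j)%N ->
  entry_from a (x :: s) j = entry_from x s j.-1.
Proof. by case: j. Qed.

Lemma increments_from_cons a x s :
  increments_from a (x :: s) = (x - a)%N :: increments_from x s.
Proof.
rewrite /increments_from /= (iotaDl 1) -map_comp; congr cons.
by apply/eq_in_map => j; rewrite mem_iota => /andP[j0 _] /=; rewrite !entry_fromS.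
Qed.

Lemma Gamma_from_cons N a b x y s t :
  Gamma_from N a b (x :: s) (y :: t) =
  [&& a <= x, b <= y, a + b < x + y & Gamma_from N x y s t]%N.
Proof.
rewrite /Gamma_from /= (iotaDl 1) all_map andbCA -!andbA; do 3!congr andb.
congr andb; apply: eq_in_all => j; rewrite mem_iota => /andP[j0 _] /=.
by rewrite add1n !entry_fromS.
Qed.

Lemma mu_from_cons m n a b x y s t :
  mu_from m n a b (x :: s) (y :: t) =
  ((if (x < m) && (y < n) then (n - y) ^ (x - a) * (m - x) ^ (y - b) else 1) *
   mu_from m n x y s t)%N.
Proof.
rewrite /mu_from [LHS]big_ltn_cond //= big_add1 /=.
have -> (P : bool) u w : (if P then u * w else w)%N = ((if P then u else 1) * w)%N.
  by case: P; rewrite ?mul1n.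
congr (_ * _)%N; rewrite big_nat_cond [RHS]big_nat_cond.
by apply: eq_big => [j|j /andP[/andP[j0 _] _]]; [apply: andb_id2l => /andP[j0 _]|];
  rewrite !entry_fromS.
Qed.

(** The contribution of one pair of sequences to [chain_sum]. *)
Fixpoint chain_weight m n a b (s t : seq nat) : nat :=
  match s, t with
  | x :: s', y :: t' => (step_weight m n a b x y * chain_weight m n x y s' t')%N
  | _, _ => (a == m) && (b == n)
  end.

(** Choosing blocks one after another turns the product of binomials on each side into a multinomial
    coefficient. *)
Lemma chain_weightE m n a b s t : (a <= m)%N -> (b <= n)%N -> size s = size t ->
  chain_weight m n a b s t =
  (Gamma_from (m + n) a b s t * (multinomial_coef (m - a) (increments_from a s) *
   multinomial_coef (n - b) (increments_from b t) * mu_from m n a b s t))%N.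
Proof.
elim: s t a b => [|x s IH] [|y t] a b //= lea leb.
  rewrite /Gamma_from /mu_from /increments_from /multinomial_coef /=.
  rewrite /entry_from /= !big_nil andbT => _.
  case: (eqVneq a m) => [->|nea]; case: (eqVneq b n) => [->|neb];
    rewrite ?eqxx ?subnn ?divn1 ?fact0 //=; lia.
case=> est; rewrite Gamma_from_cons !increments_from_cons !multinomial_coef_cons.
rewrite mu_from_cons /step_weight.
case: (leqP a x) => //= leax; case: (leqP b y) => //= leby; case: ltnP => //= _.
(* Beyond [m] or [n] a binomial vanishes on both sides of the equation; otherwise the induction
   hypothesis applies. *)
case: (leqP x m) => [lex|gtx]; last by rewrite bin_small ?mul0n ?muln0 //; lia.
case: (leqP y n) => [ley|gty]; last first.
  by rewrite ['C(n - b, _)]bin_small ?mul0n ?muln0 //; lia.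
rewrite IH // !subnBA // !subnK //.
set u := 'C(_, _); set v := 'C(_, _); set w := (if _ then _ else _).
set M1 := multinomial_coef _ _; set M2 := multinomial_coef _ _;
  set M3 := mu_from _ _ _ _ _ _.
by case: Gamma_from; rewrite ?mul0n ?muln0 // !mul1n; lia.
Qed.

Lemma big_tuple_cons (R : Type) (idx : R) (op : Monoid.com_law idx)
    (T : finType) i (F : i.+1.-tuple T -> R) :
  \big[op/idx]_t F t =
  \big[op/idx]_x \big[op/idx]_(t : i.-tuple T) F [tuple of x :: t].
Proof.
rewrite pair_bigA /= (reindex (fun p : T * i.-tuple T => [tuple of p.1 :: p.2])) //=.
exists (fun t => (thead t, [tuple of behead t])) => [[x t]|t] _ /=.
  by congr pair; apply: val_inj.
by rewrite -tuple_eta.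
Qed.

Lemma sum_chain_weight m n i a b :
  (\sum_(st : i.-tuple 'I_(m + n).+1 * i.-tuple 'I_(m + n).+1)
     chain_weight m n a b [seq val x | x <- st.1] [seq val x | x <- st.2])%N =
  chain_sum m n i a b.
Proof.
rewrite -(pair_bigA _ (fun s t : i.-tuple 'I_(m + n).+1 =>
  chain_weight m n a b [seq val x | x <- s] [seq val x | x <- t])) /=.
elim: i a b => [|i IH] a b /=.
  have t0 (s : 0.-tuple 'I_(m + n).+1) : true = (s == [tuple]).
    by apply/esym/eqP/val_inj; case: s => -[].
  by rewrite (big_pred1 [tuple] t0) (big_pred1 [tuple] t0).
rewrite [LHS]big_tuple_cons; apply: eq_bigr => x _ /=.
under eq_bigr => s _ do rewrite big_tuple_cons.
rewrite exchange_big; apply: eq_bigr => y _ /=; rewrite -IH big_distrr.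
by apply: eq_bigr => s _; rewrite big_distrr.
Qed.

Lemma sum_Gamma m n i :
  (\sum_(st in Gamma m n i) multinomial_coef m (increments st.1) *
     multinomial_coef n (increments st.2) * mu st)%N = chain_sum m n i 0 0.
Proof.
rewrite -sum_chain_weight big_mkcond /=; apply: eq_bigr => -[s t] _ /=.
rewrite chain_weightE ?size_map ?size_tuple // !subn0 inE.
have -> : Gamma_from (m + n) 0 0 [seq val x | x <- s] [seq val x | x <- t] =
  ((s, t) \in Gamma m n i) by rewrite inE /Gamma_from size_map size_tuple.
rewrite inE; case: ifP => _; rewrite ?mul0n // mul1n.
by rewrite /increments_from /mu_from !size_map !size_tuple.
Qed.

(** * Parking functions as standard vectors *)

Lemma standard0P (V : finType) (L : {set V}) (x : V -> nat) :
    L != set0 -> ~: L != set0 ->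
  standard L set0 x <-> (forall A : {set V}, A != set0 -> A != setT ->
    exists2 v, v \in A & (x v < codeg L A v)%N).
Proof.
move=> L0 R0; split=> [/andP[/andP[hL hR] /forallP std] A A0 AT|ex].
  (* A vertex missed by [A] lies on the side opposite to [M], so it is a neighbour outside [A] of
     every vertex of [M]. *)
  have sub_pos (M : {set V}) : M \subset A -> {in M, forall v, opposite L v = ~: M} ->
      {in M, forall v, 0 < codeg L A v}%N.
    move=> sMA opM v vM; rewrite card_gt0 opM //.
    have : ~~ (setT \subset A) by rewrite subTset.
    move=> /subsetPn[w _ wA]; apply/set0Pn; exists w; rewrite !inE wA.
    by apply: contra wA; apply: (subsetP sMA).
  have hole (M : {set V}) : M \subset A -> {in M, forall v, opposite L v = ~: M} ->
      [exists v in M :\: set0, x v == 0%N] ->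
      exists2 v, v \in A & (x v < codeg L A v)%N.
    move=> sMA opM /exists_inP[v]; rewrite setD0 => vM /eqP xv; exists v.
      exact: (subsetP sMA).
    by rewrite xv (sub_pos M).
  case lA: (loose L A).
    have := std A; rewrite lA properEneq eq_sym A0 sub0set /= => /forall_inPn[v].
    by rewrite setD0 -ltnNge; exists v.
  move/negbT: lA; rewrite /loose negb_and !negbK => /orP[] sA.
    by apply: (hole L) => // v; rewrite /opposite => ->.
  by apply: (hole (~: L)) => // v; rewrite inE /opposite setCK => /negPf ->.
have hole (M : {set V}) : M != set0 -> ~: M != set0 ->
    (forall v, opposite L v = if v \in M then ~: M else M) ->
    [exists v in M :\: set0, x v == 0%N].
  move=> /set0Pn[l lM] /set0Pn[r]; rewrite inE => rM opM.
  (* Outside this set lies only [r], which is seen exactly by the vertices of [M]; hence [v] is in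
     [M] and [x v < 1]. *)
  have [||v] := ex (~: [set r]).
  - by apply/set0Pn; exists l; rewrite !inE; apply: contraNneq rM => <-.
  - by apply/negP=> /eqP/setP/(_ r); rewrite !inE eqxx.
  rewrite /codeg opM setDE setCK => _ lt; apply/exists_inP; exists v.
    rewrite setD0; case: ifP lt => // _.
    suff -> : M :&: [set r] = set0 by rewrite cards0.
    by apply/setP=> w; rewrite !inE; case: eqP => [->|]; rewrite ?(negPf rM) ?andbF.
  rewrite -leqn0 -ltnS; apply: leq_trans lt _.
  by rewrite -(cards1 r); apply/subset_leq_card/subsetIr.
apply/andP; split; first (apply/andP; split).
- by apply: hole.
- apply: hole; rewrite ?setCK // => v; rewrite /opposite inE.
  by case: (v \in L).
apply/forallP=> B; apply/implyP=> /andP[lB pB].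
have [||v vB lt] := ex B.
- by rewrite -proper0.
- by apply/negP=> /eqP eB; move: lB; rewrite eB /loose subsetT.
by apply/forall_inPn; exists v; rewrite ?setD0 // -ltnNge.
Qed.

Section MonomialIdeals.
Variables (K : fieldType) (N : nat).

(** A monomial occurring in a combination of the generators occurs in a single term, hence is
    divisible by that generator. *)
Lemma in_monomial_ideal (I : finType) (Q : pred I) (e : I -> 'X_{1..N})
    (p : 'X_{1..N}) :
  in_ideal Q (fun i => 'X_[e i] : {mpoly K[N]}) 'X_[p] <->
  exists2 i, Q i & (e i <= p)%MM.
Proof.
split=> [[c E]|[i Qi le]].
  have : ('X_[p] : {mpoly K[N]})@_p != 0 by rewrite mcoeffX eqxx oner_neq0.
  rewrite E raddf_sum /= => nz.
  have /existsP[i /andP[Qi nzi]] : [exists i, Q i && ((c i * 'X_[e i])@_p != 0)].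
    apply: contraNT nz; rewrite negb_exists => /forallP z.
    rewrite big1 // => i Qi; apply/eqP; have := z i.
    by rewrite Qi negbK.
  exists i => //; move: nzi; rewrite -mcoeff_msupp (perm_mem (msuppMX _ _)).
  by case/mapP=> q _ ->; apply: lem_addr.
exists (fun j => if j == i then 'X_[p - e i] else 0).
rewrite (bigD1 i) //= eqxx -mpolyXD submK // big1 ?addr0 // => j /andP[_ /negPf ->].
by rewrite mul0r.
Qed.

Variable G : rooted_graph N.

Definition cut_mnm (A : {set 'I_N}) : 'X_{1..N} :=
  [multinom (if i \in A then outdeg G A i else 0)%N | i < N].

Lemma cut_monE A : cut_mon K G A = 'X_[cut_mnm A].
Proof.
rewrite mpolyXE_id /cut_mon big_mkcond /=; apply: eq_bigr => i _.
by rewrite mnmE; case: ifP; rewrite ?expr0.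
Qed.

Lemma in_ideal_cut_mon (Q : pred {set 'I_N}) (p : 'X_{1..N}) :
  in_ideal Q (cut_mon K G) 'X_[p] <->
  exists2 A, Q A & {in A, forall i, outdeg G A i <= p i}%N.
Proof.
have -> : in_ideal Q (cut_mon K G) 'X_[p] <->
    in_ideal Q (fun A => 'X_[cut_mnm A] : {mpoly K[N]}) 'X_[p].
  by split=> -[c ->]; exists c; apply: eq_bigr => A _; rewrite cut_monE.
rewrite in_monomial_ideal; split=> -[A QA] le; exists A => //.
  by move=> i iA; have := mnm_lepP le i; rewrite mnmE iA.
by apply/mnm_lepP=> i; rewrite mnmE; case: ifP => // /le.
Qed.

(** For [N >= 2] the size bound [N - 1] selects exactly the proper subsets, so only [setT] can put
    the monomial into the larger ideal. *)
Lemma sPFP (p : 'X_{1..N}) : (2 <= N)%N ->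
  sPF K G p <-> (forall i, outdeg G setT i <= p i)%N /\
    (forall A : {set 'I_N}, A != set0 -> A != setT ->
       exists2 i, i \in A & (p i < outdeg G A i)%N).
Proof.
move=> N2; rewrite /sPF /in_MG /in_MGk !in_ideal_cut_mon.
have cardP (A : {set 'I_N}) : (#|A| <= (N - 2).+1)%N = (A != setT).
  have -> : (A != setT) = (#|A| < N)%N.
    by rewrite -properT properEcard subsetT /= cardsT card_ord.
  lia.
have notin (A : {set 'I_N}) : A != set0 -> A != setT ->
    ~ (exists2 B, (B != set0) && (#|B| <= (N - 2).+1)%N &
        {in B, forall i, outdeg G B i <= p i}%N) ->
    exists2 i, i \in A & (p i < outdeg G A i)%N.
  move=> A0 AT no; have [/existsP[i /andP[iA lt]]|] :=
    boolP [exists i, (i \in A) && (p i < outdeg G A i)%N]; first by exists i.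
  rewrite negb_exists => /forallP all; case: no; exists A; first by rewrite A0 cardP.
  by move=> i iA; have := all i; rewrite iA -leqNgt.
split=> [[[A A0 le] no]|[le ex]].
  split=> [i|A' A'0 A'T]; last exact: notin.
  have [eA|AT] := eqVneq A setT; first by rewrite -eA; apply: le; rewrite eA inE.
  by case: no; exists A => //; rewrite A0 cardP.
split.
  exists setT => //; apply/set0Pn; exists (Ordinal (ltnW N2)).
  by rewrite inE.
case=> A /andP[A0]; rewrite cardP => AT leA; have [i iA] := ex A A0 AT.
by rewrite ltnNge leA.
Qed.
End MonomialIdeals.

(** * The graph [Kbip m n] *)

Definition left_part m n : {set 'I_(m + n)} := [set i : 'I_(m + n) | i < m]%N.

Lemma card_left_part m n : #|left_part m n| = m.
Proof.
rewrite -[RHS]card_ord -(card_imset _ (@lshift_inj m n)); apply: eq_card => i.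
rewrite inE; apply/idP/imsetP => [lt|[j _ ->]]; last by rewrite /= ltn_ord.
by exists (Ordinal lt) => //; apply: val_inj.
Qed.

(** Index [i] is vertex [i + 1], so [left_part] is the root's part without the root, and [m <= i]
    counts the edge to the root. *)
Lemma outdeg_Kbip m n (A : {set 'I_(m + n)}) i :
  outdeg (Kbip m n) A i = ((m <= i) + codeg (left_part m n) A i)%N.
Proof.
rewrite /outdeg big_mkcond big_ord_recl /= /bump /= !add1n.
have -> : ord0 \notin [set vertex k | k in A] by apply/imsetP=> -[].
congr (_ + _)%N; first by rewrite ?leq0n; case: ltnP.
rewrite /codeg -sum1_card [RHS]big_mkcond; apply: eq_bigr => j _ /=.
have -> : (lift ord0 j \in [set vertex k | k in A]) = (j \in A).
  by rewrite mem_imset //; apply: lift_inj.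
rewrite /bump /= !add1n /opposite /left_part !inE; case: (j \in A) => //=.
by case: (ltnP i m) => _; rewrite !inE; case: (ltnP j m).
Qed.

(** The condition at [setT] allows the root edges to be subtracted without truncation; the others
    become those of [standard0P]. *)
Lemma sPF_KbipP (K : fieldType) m n (p : 'X_{1..m + n}) :
    (1 <= m)%N -> (1 <= n)%N ->
  sPF K (Kbip m n) p <-> (forall i : 'I_(m + n), (m <= i) <= p i)%N /\
    standard (left_part m n) set0 (fun i => p i - (m <= i))%N.
Proof.
move=> hm hn; rewrite sPFP; last by lia.
have cL := card_left_part m n.
have cR : #|~: left_part m n| = n by rewrite cardsCs setCK cL card_ord addKn.
rewrite standard0P -?card_gt0 ?cL ?cR //.
have T0 i : outdeg (Kbip m n) setT i = (m <= i)%N :> nat.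
  by rewrite outdeg_Kbip /codeg setDT cards0 addn0.
split=> -[le ex]; (split=> [i|A A0 AT]).
- by rewrite -T0.
- by have [i iA lt] := ex A A0 AT; exists i => //; have := le i; move: lt;
  rewrite T0 outdeg_Kbip; lia.
- by rewrite T0.
by have [i iA lt] := ex A A0 AT; exists i => //; have := le i; rewrite outdeg_Kbip; lia.
Qed.

Theorem proposition3p4 (K : fieldType) (m n : nat)
    (hm : (1 <= m)%N) (hn : (1 <= n)%N) :
  exists S : {fset 'X_{1..m + n}},
    (forall P : 'X_{1..m + n}, P \in S <-> sPF K (Kbip m n) P) /\
    (#|` S|%fset%:Z : int) =
      \sum_(1 <= i < (m + n).+1) (-1) ^+ (m + n - i) *
        \sum_(st in Gamma m n i)
          (multinomial_coef m (increments st.1)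
           * multinomial_coef n (increments st.2)
           * mu st)%N%:Z.
Proof.
pose L := left_part m n; pose k := #|'I_(m + n)|.
have cL : #|L| = m := card_left_part m n.
have cR : #|~: L| = n by rewrite cardsCs setCK cL card_ord addKn.
pose D := [set f : {ffun 'I_(m + n) -> 'I_k.+1} |
             zero_on set0 f && standard L set0 (val \o f)].
pose e (f : {ffun 'I_(m + n) -> 'I_k.+1}) : 'X_{1..m + n} :=
  [multinom (f i + (m <= i))%N | i < m + n].
have e_inj : injective e.
  move=> f g /mnmP E; apply/ffunP=> i; apply: val_inj; have := E i.
  by rewrite !mnmE => /addIn.
have zero0 f : @zero_on _ k set0 f by apply/forall_inP=> i; rewrite inE.
exists [fset p in [seq e f | f <- enum D]]%fset; split=> [p|].
  rewrite !inE sPF_KbipP //; split.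
    case/mapP=> f; rewrite mem_enum inE => /andP[_ std] ->; split=> [i|].
      by rewrite mnmE leq_addl.
    by rewrite (@eq_standard _ L _ _ (val \o f)) // => i _; rewrite mnmE addnK.
  case=> le std;
    pose f : {ffun 'I_(m + n) -> 'I_k.+1} := [ffun i => inord (p i - (m <= i))].
  have fE i : f i = (p i - (m <= i))%N :> nat.
    by rewrite ffunE inordK // ltnS; apply: standard_bound std _; rewrite inE.
  apply/mapP; exists f; last by apply/mnmP=> i; rewrite mnmE fE subnK.
  rewrite mem_enum inE zero0 /=.
  by rewrite (@eq_standard _ L _ _ (fun i => p i - (m <= i))%N) // => i _ /=;
    rewrite fE.
have -> : #|` [fset p in [seq e f | f <- enum D]]|%fset = nb_standard L k set0.
  by rewrite card_fseq undup_id ?map_inj_uniq ?enum_uniq // size_map -cardE.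
have l0 : loose L set0 by rewrite /loose !subset0 -!card_gt0 cL cR hm hn.
have := signed_chains_loose (signed_chain_sum_set L) (leqnn k) l0.
rewrite cL cR !set0I set0D cards0 setC0 cardsT card_ord => E.
transitivity ((-1) ^+ (m + n) * signed_chain_sum m n 0 0).
  by rewrite E mulrA -expr2 sqrr_sign mul1r.
(* As [m] is positive, a chain from the empty set has at least one step, so the sum may start at
   1. *)
have c0 : chain_sum m n 0 0 0 = 0%N by rewrite /= eq_sym eqn0Ngt hm.
rewrite /signed_chain_sum big_ord_recl c0 mulr0 add0r.
rewrite [RHS]big_add1 [RHS]big_mkord mulr_sumr; apply: eq_bigr => i _.
rewrite lift0 mulrA -exprD; congr (_ * _).
  (* The sum and the difference of [m + n] and [i.+1] have the same parity. *)
  rewrite -signr_odd -[RHS]signr_odd; congr (_ ^+ _).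
  by rewrite oddD oddB // ltn_ord.
by rewrite -sum_Gamma -natz natr_sum; apply: eq_bigr => st _; rewrite natz.
Qed.
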